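(* For any integers $n>1$ and $1<d\le n$, $\mathsf{NUOBDD}_n^{d-1}\subsetneq\mathsf{NUOBDD}_n^{d}$.
   Context: $\mathsf{NUOBDD}_n^{d}$ denotes the class of Boolean functions $f:\{0,1\}^n\to\{0,1\}$ computable by an NUOBDD of width at most $d$. A unitary OBDD (UOBDD) of width $d$ on $n$ variables is $(Q,|\psi^0\rangle,T,Q_{acc})$: $Q=\{q_1,\dots,q_d\}$ indexes an orthonormal basis of $\mathbb{C}^d$, $|\psi^0\rangle$ a unit vector, $Q_{acc}\subseteq Q$, $T=((i_j,U_j(0),U_j(1)))_{j=1}^n$ with $(i_1,\dots,i_n)$ a permutation of $\{1,\dots,n\}$ and $U_j(b)$ unitary $d\times d$ matrices. On input $\sigma$ the final state is $|\psi^n\rangle=U_n(\sigma_{i_n})\cdots U_1(\sigma_{i_1})|\psi^0\rangle$ and the acceptance probability is $\|P_{acc}|\psi^n\rangle\|^2$ with $P_{acc}$ the projection onto the span of accepting basis states. An NUOBDD computes $f$ if for all $\sigma$: $f(\sigma)=1$ iff the acceptance probability is nonzero. *)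

(* Defs.v *)
From mathcomp Require Import all_boot all_order all_fingroup all_algebra.
From mathcomp Require Import boolp classical_sets reals.
From mathcomp Require Import complex.

Set Implicit Arguments.
Unset Strict Implicit.
Unset Printing Implicit Defensive.

Import Order.TTheory GRing.Theory Num.Theory.

Local Open Scope classical_set_scope.
Local Open Scope ring_scope.

Definition boolfun (n : nat) : Type := {ffun 'I_n -> bool} -> bool.

Definition sqnorm (R : realType) (d : nat) (v : 'cV[R[i]]_d) : R[i] :=
  \sum_(q < d) `|v q 0| ^+ 2.

(* The basis states q_1, ..., q_d are the elements of 'I_d. *)
Record uobdd (R : realType) (n d : nat) := UOBDD {
  uobdd_init : 'cV[R[i]]_d;
  uobdd_order : {perm 'I_n};
  uobdd_trans : 'I_n -> bool -> 'M[R[i]]_d;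
  uobdd_acc : {set 'I_d};
  uobdd_init_unit : sqnorm uobdd_init = 1;
  uobdd_trans_unitary : forall j b, uobdd_trans j b \is unitarymx }.

(* [enum 'I_n] is increasing, so the matrix of step 0 is applied first; step j
   reads the variable of index [uobdd_order B j]. *)
Definition final_state (R : realType) (n d : nat) (B : uobdd R n d)
    (x : {ffun 'I_n -> bool}) : 'cV[R[i]]_d :=
  foldl (fun psi j => uobdd_trans B j (x (uobdd_order B j)) *m psi)
    (uobdd_init B) (enum 'I_n).

Definition acc_proj (R : realType) (n d : nat) (B : uobdd R n d) :
    'M[R[i]]_d :=
  diag_mx (\row_q (q \in uobdd_acc B)%:R).

Definition acc_prob (R : realType) (n d : nat) (B : uobdd R n d)
    (x : {ffun 'I_n -> bool}) : R[i] :=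
  sqnorm (acc_proj B *m final_state B x).

Definition ncomputes (R : realType) (n d : nat) (B : uobdd R n d)
    (f : boolfun n) : Prop :=
  forall x, f x = true <-> acc_prob B x <> 0.

(* Width 0 contributes nothing, since 'cV_0 has no unit vector. *)
Definition NUOBDD (R : realType) (n d : nat) : set (boolfun n) :=
  [set f | exists k, (k <= d)%N /\ exists B : uobdd R n k, ncomputes B f].

Arguments NUOBDD : clear implicits.

(* Main.v *)
(* The separating function is the threshold [|x| >= m] with [m = d - 1].
   It has width [m + 1]: for [z] a primitive root of unity of order [n + 1], let
   each 1 multiply coordinate [j] by [z ^ j]; a linear form in the final state is
   then [p (z ^ |x|)] for an arbitrary [p] of degree [m], here the one with roots
   [1, z, ..., z ^ (m - 1)]. Reversibility is what forbids width [m]: if [V] is the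
   span of the states reached by short prefixes containing a 0, all of whose
   continuations by 1s must be rejected, then reading another 0 maps [V] and the
   state of the all-1 prefix, which lies outside [V], to rejected states. Hence
   [V] gains a dimension at each step, and it never contains the accepted state. *)
Require Import Defs.
From mathcomp Require Import all_boot all_order all_algebra.
From mathcomp Require Import all_fingroup all_solvable all_field.
From mathcomp Require Import boolp classical_sets reals.
From mathcomp Require Import complex.

Set Implicit Arguments.
Unset Strict Implicit.
Unset Printing Implicit Defensive.

Import Order.TTheory GRing.Theory Num.Theory.

Local Open Scope ring_scope.
Local Notation "M ^t*" := (map_mx Num.conj (M^T)) (at level 30).

(** If [v] lay in the column span of [V], then [P] would kill it as well. *)
Lemma rank_row_mx_lt (F : fieldType) (k p q : nat) (P : 'M[F]_(q, k))
    (V : 'M[F]_(k, p)) (v : 'cV[F]_k) :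
  P *m V = 0 -> P *m v <> 0 -> (\rank V < \rank (row_mx V v))%N.
Proof.
move=> PV0 Pv; rewrite -(mxrank_tr V) -(mxrank_tr (row_mx V v)) tr_row_mx -addsmxE.
apply: rank_ltmx; rewrite /ltmx addsmxSl /=; apply/negP=> sub.
apply: Pv; have /submxP[D vE] := submx_trans (addsmxSr _ _) sub.
by apply: trmx_inj; rewrite trmx_mul vE -mulmxA -trmx_mul PV0 !trmx0 mulmx0.
Qed.

Section Run.
Variables (C : numClosedFieldType) (T : Type) (k : nat) (U : T -> bool -> 'M[C]_k).

(** Kept apart from any state, so that one product acts both on [v] and on the block of columns [V];
    the first letter read is the rightmost factor. *)
Fixpoint run (s : seq T) (w : bitseq) : 'M[C]_k :=
  match s, w with
  | t :: s', b :: w' => run s' w' *m U t b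
  | _, _ => 1%:M
  end.

Lemma foldl_run (b : T -> bool) (v : 'cV[C]_k) (s : seq T) :
  foldl (fun psi t => U t (b t) *m psi) v s = run s (map b s) *m v.
Proof. by elim: s v => [|t s IHs] v /=; rewrite ?mul1mx // IHs mulmxA. Qed.

(* Induction on [s]: the columns of [V] become those of [U t false *m row_mx V v],
   and [v] becomes [U t true *m v]. *)
Lemma threshold_rank_bound (q : nat) (P : 'M[C]_(q, k)) (s : seq T) (m p : nat)
    (V : 'M[C]_(k, p)) (v : 'cV[C]_k) :
  (forall t b, U t b \in unitmx) -> (m <= size s)%N ->
  (forall w, size w = size s -> (count id w <= m)%N -> P *m (run s w *m V) = 0) ->
  (forall w, size w = size s ->
    P *m (run s w *m v) <> 0 <-> (m <= count id w)%N) ->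
  (m + \rank V < k)%N.
Proof.
move=> Uunit; elim: s m p V v => [|t s IHs] m p V v le_m killV accv.
  move: le_m; rewrite leqn0 => /eqP m0.
  rewrite m0 add0n (leq_trans _ (rank_leq_row (row_mx V v))) //.
  apply: (@rank_row_mx_lt _ _ _ _ P).
    by rewrite -[V]mul1mx; apply: (killV [::]).
  by rewrite -[v]mul1mx; apply/(accv [::]) => //; rewrite m0.
have ltV : (\rank V < \rank (row_mx V v))%N.
  (* With exactly [m] ones, [w] falls under both hypotheses: its run is rejected from [V] and
     accepted from [v]. *)
  pose w := nseq m true ++ nseq ((size s).+1 - m) false.
  have szw : size w = size (t :: s) by rewrite size_cat !size_nseq subnKC.
  have cw : count id w = m by rewrite count_cat !count_nseq mul1n mul0n addn0.
  apply: (@rank_row_mx_lt _ _ _ _ (P *m run (t :: s) w)).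
    by rewrite -mulmxA killV ?cw.
  by rewrite -mulmxA; apply/accv; rewrite ?cw.
case: m le_m killV accv => [|m] le_m killV accv.
  by rewrite add0n (leq_trans ltV) // rank_leq_row.
have := IHs m _ (U t false *m row_mx V v) (U t true *m v) le_m.
(* Reversibility enters here: [U t false] is invertible, so the dimension gained by adding [v] is
   kept. *)
have -> : \rank (U t false *m row_mx V v) = \rank (row_mx V v).
  by rewrite -mxrank_tr trmx_mul mxrankMfree ?mxrank_tr // row_free_unit unitmx_tr.
move=> IH; rewrite addSnnS (leq_ltn_trans _ (IH _ _)) ?leq_add2l //.
  (* After the 0 just read, [w] has too few ones to reach [m.+1], so [v] is rejected along with
     [V]. *)
  move=> w szw cw; rewrite (mulmxA (run s w)) !mul_mx_row.
  rewrite (killV (false :: w) (congr1 S szw)) ?leqW //.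
  suff -> : P *m (run s w *m U t false *m v) = 0 by rewrite row_mx0.
  apply/eqP; apply: contraT => /eqP/(accv (false :: w) (congr1 S szw)).
  by rewrite /= add0n ltnNge cw.
by move=> w szw; move: (accv (true :: w) (congr1 S szw)); rewrite /= add1n ltnS -mulmxA.
Qed.

End Run.

Lemma unitary_mulmxKtV (C : numClosedFieldType) (m k : nat) (A : 'M[C]_(m, k))
    (W : 'M[C]_k) : W \is unitarymx -> A *m W^t* *m W = A.
Proof. by move=> Wu; rewrite mulmxKtV. Qed.

(** The inner factors [W^t* *m W] cancel, and the remaining values of [D] merge by additivity. *)
Lemma foldl_unitary_conj (C : numClosedFieldType) (T : Type) (k : nat)
    (W : 'M[C]_k) (D : nat -> 'M[C]_k) (b : pred T) (v : 'cV[C]_k) (s : seq T) :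
  W \is unitarymx -> D 0%N = 1%:M -> {morph D : i j / (i + j)%N >-> i *m j} ->
  foldl (fun psi t => W *m D (b t) *m W^t* *m psi) (W *m v) s =
  W *m (D (count b s) *m v).
Proof.
move=> Wu D0 DD; elim: s v => [|t s IHs] v /=; first by rewrite D0 mul1mx.
by rewrite !mulmxA mulmxKtV // -mulmxA IHs addnC DD !mulmxA.
Qed.

Lemma sqnorm_eq0 (R : realType) (d : nat) (v : 'cV[R[i]]_d) :
  (sqnorm v == 0) = (v == 0).
Proof.
rewrite psumr_eq0 => [|q _]; last exact: exprn_ge0.
apply/allP/eqP => [v0|-> q _]; last by rewrite mxE normr0 expr0n eqxx.
apply/colP=> q; have := v0 q (mem_index_enum q).
by rewrite mxE expf_eq0 /= normr_eq0 => /eqP.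
Qed.

Lemma sqnorm_unitary (R : realType) (d : nat) (W : 'M[R[i]]_d) (v : 'cV[R[i]]_d) :
  W \is unitarymx -> sqnorm (W *m v) = sqnorm v.
Proof.
have sqnormE (u : 'cV[R[i]]_d) : sqnorm u = (u^t* *m u) 0 0.
  by rewrite mxE; apply: eq_bigr => q _; rewrite !mxE normCKC.
by move=> Wu; rewrite !sqnormE trmx_mul map_mxM mulmxA unitary_mulmxKtV.
Qed.

Definition threshold (n m : nat) : boolfun n :=
  fun x => (m <= count x (enum 'I_n))%N.

Lemma threshold_width (R : realType) (n m k : nat) (B : uobdd R n k) :
  (m <= n)%N -> ncomputes B (threshold m) -> (m < k)%N.
Proof.
move=> le_mn compB.
have Uunit t b : uobdd_trans B t b \in unitmx.
  exact/unitarymx_unit/uobdd_trans_unitary.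
(* Before any letter is read no prefix contains a 0, so [V] starts with no columns. *)
have := @threshold_rank_bound _ _ _ (uobdd_trans B) _ (acc_proj B) (enum 'I_n)
  m 0 0 (uobdd_init B) Uunit.
rewrite size_enum_ord mxrank0 addn0; apply=> // [w _ _|w szw].
  by rewrite !mulmx0.
(* [w] is indexed by steps and [x] by variables, hence the inverse permutation. *)
pose x := [ffun i => nth false w ((uobdd_order B)^-1%g i)].
have xw : [seq x (uobdd_order B j) | j <- enum 'I_n] = w.
  apply: (@eq_from_nth _ false); first by rewrite size_map size_enum_ord szw.
  move=> i; rewrite size_map size_enum_ord => lt_i.
  by rewrite (nth_map (Ordinal lt_i)) ?size_enum_ord // ffunE permK nth_enum_ord.
have cx : count x (enum 'I_n) = count id w.
  rewrite -xw count_map -(count_map (uobdd_order B) x).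
  apply/seq.permP/uniq_perm; rewrite ?enum_uniq ?(map_inj_uniq perm_inj) ?enum_uniq //.
  move=> i; rewrite mem_enum; apply/esym/mapP.
  by exists ((uobdd_order B)^-1%g i); rewrite ?mem_enum ?permKV.
have := compB x; rewrite /acc_prob /final_state foldl_run xw /threshold cx => compx.
split=> [/eqP nz|/compx/eqP]; last by rewrite sqnorm_eq0 => /eqP.
by apply/compx/eqP; rewrite sqnorm_eq0.
Qed.

(** As [n] is nonzero in [F], ['X^n - 1] is separable; its [n] distinct roots must include a
    primitive one. *)
Lemma prim_root_exists (F : closedFieldType) (n : nat) :
  n%:R != 0 :> F -> exists z : F, n.-primitive_root z.
Proof.
move=> nF_neq0; have n_gt0 : (0 < n)%N by case: n nF_neq0; rewrite ?eqxx.
have [rs] := closed_field_poly_normal ('X^n - 1 : {poly F}).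
rewrite (monicP (monicXnsubC 1 n_gt0)) scale1r => rsE.
have /hasP[z _ prim_z] : has n.-primitive_root rs; last by exists z.
apply: has_prim_root => //.
- by apply/allP=> z; rewrite /root_of_unity rsE root_prod_XsubC.
- by rewrite -separable_prod_XsubC -rsE separable_Xn_sub_1.
- by rewrite -ltnS -(size_prod_XsubC rs id) -rsE size_XnsubC.
Qed.

(** Gram-Schmidt yields a unitary matrix even from dependent rows, so copies of [v] can fill the
    input. This lets a single basis state read off a prescribed linear form. *)
Lemma unitary_row0 (C : numClosedFieldType) (m : nat) (v : 'rV[C]_m.+1) :
  exists2 W : 'M[C]_m.+1, W \is unitarymx & (v <= row ord0 W)%MS.
Proof.
pose A : 'M_m.+1 := \matrix_i v.
exists (schmidt A); first exact: schmidt_unitarymx.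
have := row_schmidt_sub A ord0; rewrite rowK => /submx_trans; apply.
apply/sumsmx_subP=> i; rewrite leqn0 => /eqP i0.
by rewrite genmxE (_ : i = ord0) //; apply: val_inj.
Qed.

Lemma threshold_uobdd (R : realType) (n m : nat) :
  (m <= n)%N -> exists B : uobdd R n m.+1, ncomputes B (threshold m).
Proof.
move=> le_mn; set C : numClosedFieldType := R[i].
(* Order [n.+1] keeps the powers [z ^+ e] distinct for all possible weights from 0 to [n]. *)
have [|z prim_z] := @prim_root_exists C n.+1; first by rewrite pnatr_eq0.
have norm_z : `|z| = 1.
  by apply/eqP; rewrite -(@pexpr_eq1 _ _ n.+1) // -normrX prim_expr_order // normr1.
pose p := \prod_(i <- enum 'I_m) ('X - (z ^+ i)%:P).
have sz_p : size p = m.+1 by rewrite size_prod_XsubC size_enum_ord.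
have [W Wunitary /sub_rVP[a pE]] := unitary_row0 (\row_(j < m.+1) p`_j).
pose D e : 'M[C]_m.+1 := diag_mx (\row_j (z ^+ j) ^+ e).
have D0 : D 0%N = 1%:M.
  by rewrite -diag_const_mx; congr diag_mx; apply/rowP=> j; rewrite !mxE expr0.
have DD : {morph D : e e' / (e + e')%N >-> e *m e'}.
  move=> e e'; rewrite mulmx_diag; congr diag_mx.
  by apply/rowP=> j; rewrite !mxE exprD.
have Dunitary e : D e \is unitarymx.
  apply/unitarymxP; rewrite tr_diag_mx map_diag_mx mulmx_diag -diag_const_mx.
  by congr diag_mx; apply/rowP=> j; rewrite !mxE -normCK !normrX norm_z !expr1n.
pose c : C := (sqrtC m.+1%:R)^-1.
have c_neq0 : c != 0 by rewrite invr_eq0 sqrtC_eq0 pnatr_eq0.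
pose u : 'cV[C]_m.+1 := const_mx c.
have init_unit : sqnorm (W *m u) = 1.
  rewrite sqnorm_unitary // /sqnorm; under eq_bigr do rewrite mxE.
  rewrite sumr_const card_ord normfV ger0_norm ?sqrtC_ge0 ?ler0n //.
  by rewrite exprVn sqrtCK -[LHS]mulr_natr mulVf ?pnatr_eq0.
have trans_unitary (j : 'I_n) (b : bool) : W *m D b *m W^t* \is unitarymx.
  by apply/mul_unitarymx; [apply/mul_unitarymx | rewrite trmxC_unitary].
pose B := @UOBDD R n m.+1 (W *m u) 1%g (fun _ b => W *m D b *m W^t*)
  [set ord0] init_unit trans_unitary.
have finalE x : final_state B x = W *m (D (count x (enum 'I_n)) *m u).
  rewrite -(eq_count (fun j => congr1 x (perm1 j))).
  exact: foldl_unitary_conj.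
exists B => x; rewrite /threshold; set e := count _ _.
have le_en : (e <= n)%N by rewrite (leq_trans (count_size _ _)) ?size_enum_ord.
(* Row 0 of [W], scaled by [a], lists the coefficients of [p], and the diagonal of [D e] lists the
   powers of [z ^+ e]. *)
have amp : p.[z ^+ e] * c = a * (final_state B x) 0 0.
  rewrite finalE mul_diag_mx (horner_coef_wide _ (n := m.+1)) ?sz_p // mxE.
  rewrite mulr_suml mulr_sumr; apply: eq_bigr => j _.
  have /rowP/(_ j) := pE; rewrite !mxE => ->.
  by rewrite -!exprM mulnC !mulrA mulrAC.
have p0 : (p.[z ^+ e] == 0) = (e < m)%N.
  rewrite horner_prod prodf_seq_eq0; apply/hasP/idP => [[i _]|lt_em].
    rewrite /= !hornerE subr_eq0 (eq_prim_root_expr prim_z) !modn_small ?ltnS //.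
      by move=> /eqP ->; apply: ltn_ord.
    by rewrite ltnW // (leq_trans (ltn_ord i)).
  by exists (Ordinal lt_em); rewrite ?mem_enum //= !hornerE subrr.
(* [p] is monic of degree [m], so its coefficient row has last entry 1 and cannot be zero. *)
have a_neq0 : a != 0.
  apply: contraTneq (oner_neq0 C) => a0; rewrite negbK.
  have /rowP/(_ ord_max) := pE; rewrite a0 scale0r !mxE /= => <-.
  have /monicP : p \is monic by apply: monic_prod_XsubC.
  by rewrite lead_coefE sz_p => ->.
have -> : acc_prob B x = `|final_state B x 0 0| ^+ 2.
  rewrite /acc_prob /sqnorm (bigD1 ord0) //= big1 => [|q q0]; last first.
    by rewrite /acc_proj mul_diag_mx !mxE inE (negPf q0) mul0r normr0 expr0n.
  by rewrite addr0 /acc_proj mul_diag_mx !mxE inE eqxx mul1r.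
rewrite leqNgt -p0; have -> : (p.[z ^+ e] == 0) = (`|final_state B x 0 0| ^+ 2 == 0).
  rewrite -[LHS]orbF -(negPf c_neq0) -mulf_eq0 amp mulf_eq0 (negPf a_neq0) /=.
  by rewrite expf_eq0 /= normr_eq0.
by split=> /eqP.
Qed.

Theorem theorem12 (R : realType) (n d : nat) (hn : (1 < n)%N)
    (hd1 : (1 < d)%N) (hdn : (d <= n)%N) :
  (NUOBDD R n (d - 1)%N `<` NUOBDD R n d)%classic.
Proof.
split=> [|sub].
  by move=> f [k [le_k Bf]]; exists k; split=> //; rewrite (leq_trans le_k) ?leq_subr.
have le_mn : (d.-1 <= n)%N by rewrite (leq_trans (leq_pred d)).
have /sub[k [le_k [B /(threshold_width le_mn)]]] : NUOBDD R n d (threshold d.-1).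
  by exists d; split=> //; move: (threshold_uobdd R le_mn); rewrite prednK // ltnW.
by rewrite ltnNge -subn1 le_k.
Qed.
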